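(* Let $n \geq 4$, let $R$ be an algebraic curvature operator on $\mathbb{R}^n$, and let $\hat{R}$ be the induced algebraic curvature operator on $\mathbb{R}^n \times \mathbb{R}^2$. The following statements are equivalent: (i) $\hat{R}$ has nonnegative isotropic curvature. (ii) For all orthonormal four-frames $\{e_1,e_2,e_3,e_4\}$ in $\mathbb{R}^n$ and all $\lambda,\mu \in [-1,1]$, we have \[R(e_1,e_3,e_1,e_3) + \lambda^2 \, R(e_1,e_4,e_1,e_4) + \mu^2 \, R(e_2,e_3,e_2,e_3) + \lambda^2\mu^2 \, R(e_2,e_4,e_2,e_4) - 2\lambda\mu \, R(e_1,e_2,e_3,e_4) \geq 0.\]
   Context: An algebraic curvature operator (tensor) on a Euclidean space is a four-linear form $R$ satisfying $R_{ijkl} = -R_{jikl} = -R_{ijlk} = R_{klij}$ and the first Bianchi identity, with the sign convention that $R(e_1,e_2,e_1,e_2)$ is the sectional curvature of the plane spanned by orthonormal $e_1,e_2$. The induced algebraic curvature operator $\hat{R}$ on $\mathbb{R}^n \times \mathbb{R}^2$ is defined by $\hat{R}(\hat{v}_1,\hat{v}_2,\hat{v}_3,\hat{v}_4) = R(v_1,v_2,v_3,v_4)$ for $\hat{v}_j = (v_j,x_j) \in \mathbb{R}^n \times \mathbb{R}^2$. An algebraic curvature operator $S$ has nonnegative isotropic curvature if $S_{1313} + S_{1414} + S_{2323} + S_{2424} - 2 \, S_{1234} \geq 0$ for every orthonormal four-frame $\{e_1,e_2,e_3,e_4\}$, where $S_{ijkl}=S(e_i,e_j,e_k,e_l)$.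 *)

(* Defs.v *)
(* [K : realType] is the field of real numbers. *)
From mathcomp Require Import all_boot all_order all_algebra.
From mathcomp Require Import reals.

Set Implicit Arguments.
Unset Strict Implicit.
Unset Printing Implicit Defensive.

Import Order.TTheory GRing.Theory Num.Theory.
Local Open Scope ring_scope.

(* Sign convention: [S x y x y] is the sectional curvature of the plane spanned
   by the orthonormal vectors [x], [y]. *)
Record curvature_operator (K : realType) (V : lmodType K) := CurvatureOperator {
  curv :> V -> V -> V -> V -> K;
  curv_linear1 : forall y z w, scalar (fun x => curv x y z w);
  curv_linear2 : forall x z w, scalar (fun y => curv x y z w);
  curv_linear3 : forall x y w, scalar (fun z => curv x y z w);
  curv_linear4 : forall x y z, scalar (fun w => curv x y z w);
  curv_anti12 : forall x y z w, curv x y z w = - curv y x z w;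
  curv_anti34 : forall x y z w, curv x y z w = - curv x y w z;
  curv_pair : forall x y z w, curv x y z w = curv z w x y;
  curv_bianchi : forall x y z w,
    curv x y z w + curv y z x w + curv z x y w = 0
}.

Definition induced_curv (K : realType) (V W : lmodType K)
    (R : curvature_operator V) : curvature_operator (V * W)%type.
Proof.
exists (fun v1 v2 v3 v4 : V * W => R v1.1 v2.1 v3.1 v4.1).
- by move=> y z w a u v /=; exact: curv_linear1.
- by move=> x z w a u v /=; exact: curv_linear2.
- by move=> x y w a u v /=; exact: curv_linear3.
- by move=> x y z a u v /=; exact: curv_linear4.
- by move=> x y z w; exact: curv_anti12.
- by move=> x y z w; exact: curv_anti34.
- by move=> x y z w; exact: curv_pair.
- by move=> x y z w; exact: curv_bianchi.
Defined.

Definition dotrv (K : realType) (n : nat) (u v : 'rV[K]_n) : K :=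
  \sum_(i < n) u 0 i * v 0 i.

Definition dotprod (K : realType) (n m : nat)
    (u v : 'rV[K]_n * 'rV[K]_m) : K :=
  dotrv u.1 v.1 + dotrv u.2 v.2.

Definition orthonormal_frame (K : realType) (V : Type) (ip : V -> V -> K)
    (k : nat) (e : k.-tuple V) : Prop :=
  forall i j : 'I_k, ip (tnth e i) (tnth e j) = (i == j)%:R.

(* The Euclidean structure on [V] is given by its inner product [ip]. *)
Definition nonneg_isotropic_curvature (K : realType) (V : lmodType K)
    (ip : V -> V -> K) (S : curvature_operator V) : Prop :=
  forall e1 e2 e3 e4 : V, orthonormal_frame ip [tuple e1; e2; e3; e4] ->
    0 <= S e1 e3 e1 e3 + S e1 e4 e1 e4 + S e2 e3 e2 e3 + S e2 e4 e2 e4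
         - 2 * S e1 e2 e3 e4.

(* Main.v *)
Require Import Defs.
From mathcomp Require Import all_boot all_order all_algebra.
From mathcomp Require Import reals.
From mathcomp Require Import ring lra.

Import Order.TTheory GRing.Theory Num.Theory.
Local Open Scope ring_scope.

(** Read four vectors [a], [b], [c], [d] of R^n as the two complex vectors
    [zeta = a + i b] and [eta = c + i d] of C^n. The isotropic curvature
    expression of [(a, b, c, d)] is then the Hermitian extension of [R]
    evaluated at [zeta /\ eta], namely [R (zeta, eta, conj zeta, conj eta)];
    a complex change of basis of the plane spanned by [zeta] and [eta] multiplies
    it by the squared modulus of the determinant ([isotropic_sum_scale],
    [isotropic_sum_shear], [isotropic_sum_swap]).

    From (i) to (ii): apply (i) to the frame [(e1, 0)], [(mu e2, s)], [(e3, 0)],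
    [(lambda e4, t)], with [s] and [t] orthogonal in R^2 of squared lengths
    [1 - mu^2] and [1 - lambda^2].

    From (ii) to (i): condition (ii) in fact forces the expression to be
    nonnegative at all vectors [a], [b], [c], [d] of R^n
    ([nonneg_isotropic_sum]), hence at the first components of any frame of
    R^n x R^2. The reason is that the complex bilinear form [g] extending the
    inner product and the associated Hermitian form [h] can be diagonalised
    together on a complex plane (Takagi factorisation), with [g] made real and
    nonnegative. Concretely, a Gram-Schmidt step makes [zeta] and [eta]
    orthogonal for [h]. Replacing [zeta] by [zeta + t eta], and [eta] by the
    [h]-orthogonal direction of the same plane, makes them orthogonal for [g]
    too, provided the complex number [t] solves an equation that is a special
    case of [conic_system]; being orthogonal for both forms means that [a] and
    [b] are orthogonal to [c] and [d]. Finally a phase change of each of [zeta]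
    and [eta] makes [a] orthogonal to [b] with [|b| <= |a|], and [c] orthogonal
    to [d] with [|d| <= |c|] ([exists_phase]). Such a quadruple is
    [|a| e1, mu |a| e2, |c| e3, lambda |c| e4] for an orthonormal frame [e], and
    its isotropic curvature expression is [|a|^2 |c|^2] times the one in (ii). *)

Set Implicit Arguments.
Unset Strict Implicit.

(** * The isotropic curvature expression as a function of a complex plane *)

Lemma scalarDZ (K : realType) (V : lmodType K) (f : V -> K) : scalar f ->
  (forall u v, f (u + v) = f u + f v) * (forall k u, f (k *: u) = k * f u).
Proof.
move=> lf.
have fD u v : f (u + v) = f u + f v by rewrite -[u]scale1r lf mul1r scale1r.
have f0 : f 0 = 0 by apply: (addrI (f 0)); rewrite -fD !addr0.
by split=> // k u; rewrite -[k *: u]addr0 lf f0 addr0.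
Qed.

Local Notation "''[' u , v ]" := (dotrv u v).

Section Curvature.
Variables (K : realType) (V : lmodType K) (R : curvature_operator V).

Let curvDZ1 y z w := scalarDZ (curv_linear1 R y z w).
Let curvDZ2 x z w := scalarDZ (curv_linear2 R x z w).
Let curvDZ3 x y w := scalarDZ (curv_linear3 R x y w).
Let curvDZ4 x y z := scalarDZ (curv_linear4 R x y z).
Let curvDZ := (curvDZ1, curvDZ2, curvDZ3, curvDZ4).

Lemma curv_diag12 x z w : R x x z w = 0.
Proof. by have := curv_anti12 R x x z w; lra. Qed.

Lemma curv_diag34 x y z : R x y z z = 0.
Proof. by have := curv_anti34 R x y z z; lra. Qed.

Definition isotropic_sum a b c d : K :=
  R a c a c + R a d a d + R b c b c + R b d b d - 2 * R a b c d.

Lemma isotropic_sum_swap a b c d : isotropic_sum c d a b = isotropic_sum a b c d.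
Proof.
rewrite /isotropic_sum (curv_pair R c d a b).
have E x y : R x y x y = R y x y x.
  by rewrite (curv_anti12 R x y) (curv_anti34 R y x x y) opprK.
by rewrite (E c a) (E c b) (E d a) (E d b); ring.
Qed.

(** Effect of multiplying [a + i b] by the complex number [x + i y]: the complex
    line is unchanged, so only the squared modulus comes out. *)
Lemma isotropic_sum_scale a b c d x y :
  isotropic_sum (x *: a + - y *: b) (y *: a + x *: b) c d =
  (x ^+ 2 + y ^+ 2) * isotropic_sum a b c d.
Proof.
rewrite /isotropic_sum !curvDZ !curv_diag12 (curv_anti12 R b a c d).
rewrite (curv_pair R b c a c) (curv_pair R b d a d); ring.
Qed.

(** Effect of adding to [c + i d] the multiple [(x + i y) (a + i b)], which does
    not change the bivector [(a + i b) /\ (c + i d)]. *)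
Lemma isotropic_sum_shear a b c d x y :
  isotropic_sum a b (c + (x *: a + - y *: b)) (d + (y *: a + x *: b)) =
  isotropic_sum a b c d.
Proof.
rewrite /isotropic_sum !curvDZ !(curv_diag12, curv_diag34).
have E z w : R z w b a = - R z w a b by exact: curv_anti34.
have F z w : R b a z w = - R a b z w by exact: curv_anti12.
rewrite !(E, F).
rewrite (curv_pair R a c a b) (curv_pair R a d a b).
rewrite (curv_pair R b c a b) (curv_pair R b d a b).
rewrite (curv_anti34 R a b c a) (curv_anti34 R a b c b).
ring.
Qed.

Lemma isotropic_sum0 c d : isotropic_sum 0 0 c d = 0.
Proof.
have := isotropic_sum_scale 0 0 c d 0 0.
by rewrite !scaler0 addr0 => ->; ring.
Qed.

Lemma isotropic_sumZ a b c d k1 k2 k3 k4 :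
  isotropic_sum (k1 *: a) (k2 *: b) (k3 *: c) (k4 *: d) =
  (k1 * k3) ^+ 2 * R a c a c + (k1 * k4) ^+ 2 * R a d a d +
  (k2 * k3) ^+ 2 * R b c b c + (k2 * k4) ^+ 2 * R b d b d
  - 2 * (k1 * k2 * k3 * k4) * R a b c d.
Proof. by rewrite /isotropic_sum !curvDZ; ring. Qed.

End Curvature.

(** * Orthogonality in R^n *)

Section DotProduct.
Variables (K : realType) (n : nat).
Implicit Types u v w : 'rV[K]_n.

Lemma dotrvC u v : '[u, v] = '[v, u].
Proof. by apply: eq_bigr => i _; rewrite mulrC. Qed.

Lemma dotrvDl u v w : '[u + v, w] = '[u, w] + '[v, w].
Proof. by rewrite -big_split; apply: eq_bigr => i _; rewrite mxE mulrDl. Qed.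

Lemma dotrvZl k u w : '[k *: u, w] = k * '[u, w].
Proof. by rewrite /dotrv mulr_sumr; apply: eq_bigr => i _; rewrite mxE mulrA. Qed.

Lemma dotrvDr u v w : '[w, u + v] = '[w, u] + '[w, v].
Proof. by rewrite !(dotrvC w) dotrvDl. Qed.

Lemma dotrvZr k u w : '[w, k *: u] = k * '[w, u].
Proof. by rewrite !(dotrvC w) dotrvZl. Qed.

Definition dotrvE := (dotrvDl, dotrvDr, dotrvZl, dotrvZr).

Lemma dotrv_ge0 u : 0 <= '[u, u].
Proof. by apply: sumr_ge0 => i _; rewrite -expr2 sqr_ge0. Qed.

Lemma dotrv_eq0 u : '[u, u] = 0 -> u = 0.
Proof.
move/eqP; rewrite psumr_eq0 => [|i _]; last by rewrite -expr2 sqr_ge0.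
move/allP => u0; apply/rowP => i; rewrite mxE; apply/eqP.
by have := u0 i; rewrite mem_index_enum mulf_eq0 orbb; apply.
Qed.

Lemma dotrv_gt0 u : u != 0 -> 0 < '[u, u].
Proof.
by rewrite lt_def dotrv_ge0 andbT; apply: contraNneq => /dotrv_eq0->.
Qed.

Lemma dotrv_normalize u : u != 0 ->
  exists2 e, '[e, e] = 1 & exists2 k, 0 <= k & u = k *: e.
Proof.
move=> u0; set r := Num.sqrt '[u, u].
have r0 : r != 0 by rewrite gt_eqF // sqrtr_gt0 dotrv_gt0.
exists (r^-1 *: u); last first.
  by exists r; rewrite ?sqrtr_ge0 // scalerA divff // scale1r.
by rewrite !dotrvE -['[u, u]]sqr_sqrtr ?dotrv_ge0 // -/r; field.
Qed.

Lemma exists_orthogonal3 (x y z : 'rV[K]_n) : (3 < n)%N ->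
  exists2 u, u != 0 & [/\ '[u, x] = 0, '[u, y] = 0 & '[u, z] = 0].
Proof.
move=> n3; pose A : 'M[K]_(n, 3) := \matrix_(i, j) [tuple x; y; z]`_j 0 i.
have /rowV0Pn[u /sub_kermxP uA u0] : kermx A != 0.
  by rewrite kermx_eq0 /row_free ltn_eqF // (leq_ltn_trans (rank_leq_col A) n3).
exists u => //.
have E (j : 'I_3) : '[u, [tuple x; y; z]`_j] = 0.
  transitivity ((u *m A) 0 j); last by rewrite uA mxE.
  by rewrite mxE; apply: eq_bigr => i _; rewrite mxE.
by split; [exact: (E 0) | exact: (E 1) | exact: (E 2)].
Qed.

(** When [w = 0] the direction [e] still exists because the ambient dimension
    exceeds three. It lets frames be built from vectors that may vanish. *)
Lemma polar3 (w x y z : 'rV[K]_n) : (3 < n)%N ->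
  '[w, x] = 0 -> '[w, y] = 0 -> '[w, z] = 0 ->
  exists e k, [/\ '[e, e] = 1, 0 <= k, w = k *: e &
    [/\ '[e, x] = 0, '[e, y] = 0 & '[e, z] = 0]].
Proof.
move=> n3 wx wy wz.
have [u [u0 [ux uy uz] [l l0 wu]]] : exists u, [/\ u != 0,
    [/\ '[u, x] = 0, '[u, y] = 0 & '[u, z] = 0] &
    exists2 l, 0 <= l & w = l *: u].
  have [w0|w0] := eqVneq w 0.
    have [u u0 uo] := exists_orthogonal3 x y z n3.
    by exists u; split=> //; exists 0; rewrite ?scale0r.
  by exists w; split=> //; exists 1; rewrite ?scale1r.
have [e e1 [k k0 uk]] := dotrv_normalize u0.
have k_neq0 : k != 0 by apply: contraNneq u0 => k00; rewrite uk k00 scale0r.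
have eo v : '[u, v] = 0 -> '[e, v] = 0.
  by rewrite uk dotrvZl => /eqP; rewrite mulf_eq0 (negPf k_neq0) => /eqP.
exists e, (l * k); split; [by []|exact: mulr_ge0| |by split; apply: eo].
by rewrite wu uk scalerA.
Qed.

End DotProduct.

Lemma frame4P (K : realType) (V : Type) (ip : V -> V -> K) (e1 e2 e3 e4 : V) :
  (forall u v, ip u v = ip v u) ->
  orthonormal_frame ip [tuple e1; e2; e3; e4] <->
  [/\ ip e1 e1 = 1, ip e2 e2 = 1, ip e3 e3 = 1 & ip e4 e4 = 1] /\
  [/\ ip e1 e2 = 0, ip e1 e3 = 0 & ip e1 e4 = 0] /\
  [/\ ip e2 e3 = 0, ip e2 e4 = 0 & ip e3 e4 = 0].
Proof.
move=> ipC; split=> [F|[[i11 i22 i33 i44] [[i12 i13 i14] [i23 i24 i34]]]].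
  have E i j : (i < 4)%N -> (j < 4)%N ->
      ip (nth e1 [:: e1; e2; e3; e4] i) (nth e1 [:: e1; e2; e3; e4] j) =
      (i == j)%:R.
    by move=> i4 j4; have := F (Ordinal i4) (Ordinal j4); rewrite !(tnth_nth e1).
  split.
    by split; [exact: (E 0 0)|exact: (E 1 1)|exact: (E 2 2)|exact: (E 3 3)].
  split; first by split; [exact: (E 0 1)|exact: (E 0 2)|exact: (E 0 3)].
  by split; [exact: (E 1 2)|exact: (E 1 3)|exact: (E 2 3)].
move=> i j; rewrite !(tnth_nth e1) -val_eqE.
by case: i j => [[|[|[|[|//]]]] ?] [[|[|[|[|//]]]] ?] //=; rewrite ipC.
Qed.

(** * Existence of adapted complex bases *)

(** If the left-hand matrix is singular, a kernel vector of squared length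
    [M / N] makes both sides vanish. Otherwise invert it at the right-hand side
    [(e, f)] and look for a solution along the resulting vector: its factor [s]
    is then a root of [N W s^2 + s - M] with [W >= 0], whose discriminant is
    positive. *)
Lemma conic_system (K : realType) (a b c d e f M N : K) : 0 < M -> 0 < N ->
  exists p q : K, a * p + b * q = e * (M - N * (p ^+ 2 + q ^+ 2)) /\
              c * p + d * q = f * (M - N * (p ^+ 2 + q ^+ 2)).
Proof.
move=> M0 N0; have [D0|D0] := eqVneq (a * d - b * c) 0.
  have [u [v [uv0 au cu]]] : exists u v : K,
      [/\ 0 < u ^+ 2 + v ^+ 2, a * u + b * v = 0 & c * u + d * v = 0].
    have pos (x y : K) : (x != 0) || (y != 0) -> 0 < x ^+ 2 + y ^+ 2.
      move=> xy; rewrite lt_def addr_ge0 ?sqr_ge0 // andbT.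
      by rewrite paddr_eq0 ?sqr_ge0 // !sqrf_eq0 negb_and.
    have [ab|] := boolP ((b != 0) || (a != 0)).
      exists (- b), a; split; [by apply: pos; rewrite oppr_eq0|ring|].
      by rewrite -D0; ring.
    rewrite negb_or !negbK => /andP[/eqP-> /eqP->].
    have [cd|] := boolP ((d != 0) || (c != 0)).
      exists (- d), c; split; [by apply: pos; rewrite oppr_eq0|ring|ring].
    rewrite negb_or !negbK => /andP[/eqP-> /eqP->].
    by exists 1, 0; split; [apply: pos; rewrite oner_eq0|ring|ring].
  pose r := Num.sqrt (M / (N * (u ^+ 2 + v ^+ 2))).
  have r2 : M - N * ((r * u) ^+ 2 + (r * v) ^+ 2) = 0.
    have : r ^+ 2 = M / (N * (u ^+ 2 + v ^+ 2)).
      by rewrite sqr_sqrtr // divr_ge0 ?mulr_ge0 // ltW.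
    rewrite !exprMn => ->; field.
    by rewrite !gt_eqF.
  exists (r * u), (r * v); rewrite r2; split.
    by transitivity (r * (a * u + b * v)); [ring|rewrite au; ring].
  by transitivity (r * (c * u + d * v)); [ring|rewrite cu; ring].
pose p := (e * d - b * f) / (a * d - b * c).
pose q := (a * f - e * c) / (a * d - b * c).
pose W := p ^+ 2 + q ^+ 2.
have W0 : 0 <= W by rewrite addr_ge0 ?sqr_ge0.
pose r := Num.sqrt (1 + 4 * M * N * W).
have r2 : r ^+ 2 = 1 + 4 * M * N * W.
  by rewrite sqr_sqrtr // addr_ge0 // !mulr_ge0 // ltW.
have r0 : 0 <= r by exact: sqrtr_ge0.
have r1 : 1 + r != 0 by rewrite gt_eqF // ltr_wpDr.
(* The positive root, in the form that remains valid when [W = 0]. *)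
pose s := 2 * M / (1 + r).
have sE : M - N * ((s * p) ^+ 2 + (s * q) ^+ 2) = s.
  have -> : N * ((s * p) ^+ 2 + (s * q) ^+ 2) = M * (r ^+ 2 - 1) / (1 + r) ^+ 2.
    by rewrite r2 /s /W; field.
  by rewrite /s; field.
by exists (s * p), (s * q); rewrite sE; split; rewrite /p /q; field.
Qed.

(** Multiplying [zeta = a + i b] by a suitable nonzero complex number [x + i y]
    makes [g (zeta, zeta) = |a|^2 - |b|^2 + 2 i <a, b>] real and nonnegative. *)
Lemma exists_phase (K : realType) (n : nat) (a b : 'rV[K]_n) : exists x y, [/\ 0 < x ^+ 2 + y ^+ 2,
  '[x *: a + - y *: b, y *: a + x *: b] = 0 &
  '[y *: a + x *: b, y *: a + x *: b] <=
  '[x *: a + - y *: b, x *: a + - y *: b]].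
Proof.
(* With the multiplier [1 + i p], the new inner product is
   [p (|a|^2 - |b|^2) + (1 - p^2) <a, b>]; the second equation only forces
   [q = 0]. *)
have [p [q [E1]]] := @conic_system K (- ('[a, a] - '[b, b])) 0 0 1 '[a, b] 0 1 1
  ltr01 ltr01.
rewrite !mul0r mul1r add0r => q0; rewrite {}q0 in E1.
have pos : 0 < 1 ^+ 2 + p ^+ 2 :> K by rewrite expr1n ltr_pwDl ?sqr_ge0.
have orth : '[1 *: a + - p *: b, p *: a + 1 *: b] = 0.
  rewrite !dotrvE (dotrvC b a).
  transitivity ('[a, b] * (1 - 1 * (p ^+ 2 + 0 ^+ 2)) -
    (- ('[a, a] - '[b, b]) * p + 0 * 0)); first by ring.
  by rewrite E1 subrr.
have [le|/ltW le] := lerP '[p *: a + 1 *: b, p *: a + 1 *: b]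
                    '[1 *: a + - p *: b, 1 *: a + - p *: b].
  by exists 1, p.
(* A further multiplication by [i] exchanges the two lengths. *)
exists (- p), 1; split; first by rewrite sqrrN addrC.
- rewrite -[RHS]oppr0 -orth !dotrvE (dotrvC b a); ring.
- move: le; rewrite !dotrvE (dotrvC b a).
  by congr (_ <= _); ring.
Qed.

(** * Nonnegativity on all quadruples of vectors *)

Section NonnegativeComplexCurvature.
Variables (K : realType) (n : nat) (n3 : (3 < n)%N).
Variable R : curvature_operator 'rV[K]_n.
Local Notation Q := (isotropic_sum R).

Hypothesis nonneg_frame : forall e1 e2 e3 e4 : 'rV[K]_n,
  orthonormal_frame (@dotrv K n) [tuple e1; e2; e3; e4] ->
  forall l m : K, -1 <= l <= 1 -> -1 <= m <= 1 ->
  0 <= R e1 e3 e1 e3 + l ^+ 2 * R e1 e4 e1 e4 + m ^+ 2 * R e2 e3 e2 e3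
       + l ^+ 2 * m ^+ 2 * R e2 e4 e2 e4 - 2 * l * m * R e1 e2 e3 e4.

(** The diagonal case. The frame is built one vector at a time by [polar3], each
    vector being replaced by its direction before the next one is treated, so
    that vanishing vectors are allowed. *)
Lemma nonneg_orthogonal (a b c d : 'rV[K]_n) :
  '[a, b] = 0 -> '[c, d] = 0 ->
  '[a, c] = 0 -> '[a, d] = 0 -> '[b, c] = 0 -> '[b, d] = 0 ->
  '[b, b] <= '[a, a] -> '[d, d] <= '[c, c] -> 0 <= Q a b c d.
Proof.
move=> ab cd ac ad bc bd ba dc.
have C (u v : 'rV[K]_n) : '[u, v] = 0 -> '[v, u] = 0 by rewrite dotrvC.
have [e1 [k1 [e11 k1_ge0 a_e [e1b e1c e1d]]]] := polar3 n3 ab ac ad.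
have [e2 [k2 [e22 k2_ge0 b_e [e21 e2c e2d]]]] :=
  polar3 n3 (C _ _ e1b) bc bd.
have [e3 [k3 [e33 k3_ge0 c_e [e31 e32 e3d]]]] :=
  polar3 n3 (C _ _ e1c) (C _ _ e2c) cd.
have [e4 [k4 [e44 k4_ge0 d_e [e41 e42 e43]]]] :=
  polar3 n3 (C _ _ e1d) (C _ _ e2d) (C _ _ e3d).
have ratio k k' (e e' : 'rV[K]_n) : 0 <= k -> 0 <= k' -> '[e, e] = 1 -> '[e', e'] = 1 ->
    '[k' *: e', k' *: e'] <= '[k *: e, k *: e] ->
    exists2 l, k' = k * l & -1 <= l <= 1.
  move=> k0 k'0 ee ee'; rewrite !dotrvE ee ee' !mulr1 -!expr2.
  rewrite ler_sqr ?nnegrE // => kk'; have [k00|k_neq0] := eqVneq k 0.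
    by exists 0; [apply: le_anti; rewrite k00 mul0r k'0 -k00 kk'|rewrite lerN10 ler01].
  have kpos : 0 < k by rewrite lt_def k_neq0.
  exists (k' / k); first by rewrite mulrC divfK.
  rewrite ler_pdivrMr // mul1r kk' andbT.
  by apply: le_trans (divr_ge0 k'0 k0); rewrite lerN10.
move: ba dc; rewrite a_e b_e c_e d_e => ba dc.
(* These ratios are the parameters [mu] and [lambda] of the hypothesis. *)
have [m k2E m1] := ratio _ _ _ _ k1_ge0 k2_ge0 e11 e22 ba.
have [l k4E l1] := ratio _ _ _ _ k3_ge0 k4_ge0 e33 e44 dc.
have /nonneg_frame/(_ l m l1 m1) : orthonormal_frame (@dotrv K n) [tuple e1; e2; e3; e4].
  by apply/frame4P; [exact: dotrvC|split; split; try split; rewrite // dotrvC].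
move/(mulr_ge0 (sqr_ge0 (k1 * k3))); congr (_ <= _).
by rewrite isotropic_sumZ k2E k4E; ring.
Qed.

(** Multiplying [a + i b] and [c + i d] by the factors that [exists_phase]
    provides preserves the orthogonality of [a], [b] to [c], [d] and reduces to
    the diagonal case. *)
Lemma nonneg_cross_orthogonal (a b c d : 'rV[K]_n) :
  '[a, c] = 0 -> '[a, d] = 0 -> '[b, c] = 0 -> '[b, d] = 0 -> 0 <= Q a b c d.
Proof.
move=> ac ad bc bd.
have [x [y [xy ab ba]]] := exists_phase a b.
have [z [t [zt cd dc]]] := exists_phase c d.
rewrite -(pmulr_rge0 _ xy) -isotropic_sum_scale -isotropic_sum_swap.
rewrite -(pmulr_rge0 _ zt) -isotropic_sum_scale -isotropic_sum_swap.
by apply: nonneg_orthogonal; rewrite // !dotrvE ac ad bc bd; ring.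
Qed.

(** Any complex plane has a basis orthogonal for both [g] and [h], in the
    notation of the introduction, and such a basis falls under
    [nonneg_cross_orthogonal]. *)
Lemma nonneg_isotropic_sum a b c d : 0 <= Q a b c d.
Proof.
have zero (u v : 'rV[K]_n) : '[u, u] + '[v, v] = 0 -> u = 0 /\ v = 0.
  move/eqP; rewrite paddr_eq0 ?dotrv_ge0 //.
  by case/andP=> /eqP/dotrv_eq0-> /eqP/dotrv_eq0->.
pose M := '[a, a] + '[b, b].
have [/zero[-> ->]|M_neq0] := eqVneq M 0; first by rewrite isotropic_sum0.
have M_gt0 : 0 < M by rewrite lt_def M_neq0 addr_ge0 ?dotrv_ge0.
(* Gram-Schmidt: [x + i y = - h (eta, zeta) / h (zeta, zeta)]. *)
pose x := - ('[a, c] + '[b, d]) / M; pose y := ('[b, c] - '[a, d]) / M.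
rewrite -(isotropic_sum_shear _ _ _ _ _ x y).
have: '[b, d + (y *: a + x *: b)] = - '[a, c + (x *: a + - y *: b)].
  by rewrite !dotrvE (dotrvC b a) /x /y /M; field.
have: '[a, d + (y *: a + x *: b)] = '[b, c + (x *: a + - y *: b)].
  by rewrite !dotrvE (dotrvC b a) /x /y /M; field.
move: (c + _) (d + _) => {x y} {}c {}d ad bd.
pose N := '[c, c] + '[d, d].
have [/zero[-> ->]|N_neq0] := eqVneq N 0.
  by rewrite -isotropic_sum_swap isotropic_sum0.
have N_gt0 : 0 < N by rewrite lt_def N_neq0 addr_ge0 ?dotrv_ge0.
(* Now [h (eta, zeta) = 0], [M = h (zeta, zeta)] and [N = h (eta, eta)]. Put
   [A = g (zeta, zeta)], [B = g (zeta, eta)], [C = g (eta, eta)] and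
   [t = p + i q]; by [ad] and [bd], [B = 2 <a, c> + 2 i <b, c>]. The vectors
   [zeta + t eta] and [M eta - N (conj t) zeta] are [h]-orthogonal, and they are
   [g]-orthogonal when [N A (conj t) - M C t = B (M - N |t|^2)], whose real and
   imaginary parts are the two equations below. *)
pose A1 := '[a, a] - '[b, b]; pose A2 := 2 * '[a, b].
pose C1 := '[c, c] - '[d, d]; pose C2 := 2 * '[c, d].
have [p [q [E1 E2]]] := @conic_system K (N * A1 - M * C1) (N * A2 + M * C2)
  (N * A2 - M * C2) (- N * A1 - M * C1) (2 * '[a, c]) (2 * '[b, c]) M N M_gt0 N_gt0.
(* [M eta - N (conj t) zeta = k eta - N (conj t) (zeta + t eta)], so that, after
   division by [k], the new basis is reached from the old one by two shears. *)
pose k := M + N * (p ^+ 2 + q ^+ 2).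
have k_neq0 : k != 0.
  by rewrite gt_eqF // ltr_pwDl // mulr_ge0 ?(ltW N_gt0) // addr_ge0 ?sqr_ge0.
rewrite -isotropic_sum_swap -(isotropic_sum_shear _ _ _ _ _ p q).
rewrite -isotropic_sum_swap.
rewrite -(isotropic_sum_shear _ _ _ _ _ (- N * p / k) (N * q / k)).
set a' := a + _; set b' := b + _; set c' := c + _; set d' := d + _.
have dotC := (dotrvC b a, dotrvC c a, dotrvC d a, dotrvC c b,
  dotrvC d b, dotrvC d c, ad, bd).
have expand := (dotrvE, dotC).
(* [h1], [h2] express orthogonality for [h], and [g1], [g2] for [g]. *)
have h1 : '[a', c'] + '[b', d'] = 0.
  by rewrite !expand; move: k_neq0; rewrite /k /M /N => ?; field.
have h2 : '[a', d'] - '[b', c'] = 0.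
  by rewrite !expand; move: k_neq0; rewrite /k /M /N => ?; field.
have g1 : '[a', c'] - '[b', d'] = 0.
  transitivity ((2 * '[a, c] * (M - N * (p ^+ 2 + q ^+ 2)) -
    ((N * A1 - M * C1) * p + (N * A2 + M * C2) * q)) / k).
    rewrite !expand /A1 /A2 /C1 /C2; move: k_neq0; rewrite /k /M /N => ?.
    by field.
  by rewrite E1 subrr mul0r.
have g2 : '[a', d'] + '[b', c'] = 0.
  transitivity ((2 * '[b, c] * (M - N * (p ^+ 2 + q ^+ 2)) -
    ((N * A2 - M * C2) * p + (- N * A1 - M * C1) * q)) / k).
    rewrite !expand /A1 /A2 /C1 /C2; move: k_neq0; rewrite /k /M /N => ?.
    by field.
  by rewrite E2 subrr mul0r.
by apply: nonneg_cross_orthogonal; lra.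
Qed.

End NonnegativeComplexCurvature.

(** * The equivalence *)

Theorem proposition21 (K : realType) (n : nat) (hn : (4 <= n)%N)
    (R : curvature_operator 'rV[K]_n) :
  nonneg_isotropic_curvature (@dotprod K n 2) (induced_curv 'rV[K]_2 R)
  <->
  (forall e1 e2 e3 e4 : 'rV[K]_n,
     orthonormal_frame (@dotrv K n) [tuple e1; e2; e3; e4] ->
   forall lambda mu : K, -1 <= lambda <= 1 -> -1 <= mu <= 1 ->
     0 <= R e1 e3 e1 e3 + lambda ^+ 2 * R e1 e4 e1 e4
          + mu ^+ 2 * R e2 e3 e2 e3
          + lambda ^+ 2 * mu ^+ 2 * R e2 e4 e2 e4
          - 2 * lambda * mu * R e1 e2 e3 e4).
Proof.
split=> [nicR e1 e2 e3 e4 frame l m l1 m1|nonneg_frame e1 e2 e3 e4 _]; last first.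
  exact: (nonneg_isotropic_sum hn nonneg_frame).
have compl (x : K) : -1 <= x <= 1 -> Num.sqrt (1 - x ^+ 2) ^+ 2 = 1 - x ^+ 2.
  by case/andP=> x_ge x_le; rewrite sqr_sqrtr //; nra.
have dotprodC : forall u v, @dotprod K n 2 u v = dotprod v u.
  by move=> u v; rewrite /dotprod !(dotrvC v.1, dotrvC v.2).
have [[f11 f22 f33 f44] [[f12 f13 f14] [f23 f24 f34]]] :=
  (frame4P e1 e2 e3 e4 (@dotrvC K n)).1 frame.
pose d0 : 'rV[K]_2 := delta_mx 0 0; pose d1 : 'rV[K]_2 := delta_mx 0 1.
have [d00 d11 d01] : [/\ '[d0, d0] = 1, '[d1, d1] = 1 & '[d0, d1] = 0].
  by split; rewrite /dotrv !big_ord_recl big_ord0 !mxE /=; ring.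
have prodE u v x y u' v' x' y' :
    @dotprod K n 2 (u *: v, x *: y) (u' *: v', x' *: y') =
    u * u' * '[v, v'] + x * x' * '[y, y'].
  by rewrite /dotprod /= !dotrvE; ring.
(* Trivial factors [1] and [0] give all entries the shape expected by [prodE]. *)
have /nicR : orthonormal_frame (@dotprod K n 2) [tuple
    (1 *: e1, 0 *: d0); (m *: e2, Num.sqrt (1 - m ^+ 2) *: d0);
    (1 *: e3, 0 *: d0); (l *: e4, Num.sqrt (1 - l ^+ 2) *: d1)].
  apply/frame4P => //.
  rewrite !prodE f11 f22 f33 f44 f12 f13 f14 f23 f24 f34 d00 d11 d01 -!expr2.
  by rewrite !compl //; do ?split; ring.
rewrite /= -/(isotropic_sum R _ _ _ _) isotropic_sumZ.
by congr (_ <= _); ring.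
Qed.
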